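(* Let $n$ be a non-negative integer, and let $I^{[n]}\subset\Lambda/\mathcal{I}_n$ be the ideal generated by the elements $$\beta_k^{[n]}:=e_k+\sum_{j\geq k}(-1)^{j+1}\binom{j}{k}e_j\in\Lambda/\mathcal{I}_n,\qquad k\geq 0.$$ Suppose $f\in\Lambda$ satisfies $\overline{f}\in I^{[n]}$, where $\overline{f}$ is the reduction of $f$ modulo $\mathcal{I}_n$. Then the congruence $$f\left(\frac{p}{1},\frac{p}{2},\ldots,\frac{p}{p-1}\right)\equiv 0\mod p^n$$ holds for all sufficiently large primes $p$.
   Context: $\Lambda=\Lambda_{\mathbb{Q}}$ is the ring of symmetric functions over $\mathbb{Q}$: formal power series of bounded degree in countably many variables with rational coefficients, invariant under all permutations of the variables. $e_k$ is the $k$-th elementary symmetric function ($e_0=1$); $\Lambda$ is the free commutative $\mathbb{Q}$-algebra on $e_1,e_2,\ldots$. A symmetric function is evaluated at a finite list of rationals by setting the remaining variables to $0$. The grading by $H$-degree on $\Lambda$ is the multiplicative grading in which $e_k$ (for $k\geq 1$) is homogeneous of $H$-degree $k+1$ (constants have $H$-degree $0$). For $f=\sum_m f_m$ with $f_m$ homogeneous of $H$-degree $m$, put $v(f):=\inf\{m: f_m\neq 0\}\in\mathbb{Z}_{\geq 0}\cup\{\infty\}$, and define the ideal $\mathcal{I}_n:=\{f\in\Lambda: v(f)\geq n\}$. The sum defining $\beta_k^{[n]}$ is finite since $e_j\in\mathcal{I}_n$ for all sufficiently large $j$. For $f\in\Lambda$ and all sufficiently large primes $p$ the value $f(p/1,\ldots,p/(p-1))$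 lies in the localization $\mathbb{Z}_{(p)}$, and congruences modulo $p^n$ are understood in $\mathbb{Z}_{(p)}$. *)

(* Defs.v *)
From HB Require Import structures.
From mathcomp Require Import all_boot all_order all_algebra finmap.
From mathcomp Require Import boolp classical_sets functions cardinality fsbigop.
From mathcomp Require Import monalg zify.
Set Implicit Arguments.
Unset Strict Implicit.
Unset Printing Implicit Defensive.
Import Order.TTheory GRing.Theory Num.Theory.
Local Open Scope classical_set_scope.
Local Open Scope ring_scope.
Local Notation "1" := (@mone _) : monom_scope.
Local Notation "x * y" := (mmul x y) : monom_scope.

(* Formal power series over R in the countably many variables x_0, x_1, ... *)
(* A series is its family of coefficients; a monomial m : {cmonom nat} is a *)
(* finitely supported exponent function, and {cmonom nat} is written        *)
(* multiplicatively.                                                        *)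

Record pseries (R : Type) := PSeries { pscoef : {cmonom nat} -> R }.
Coercion pscoef : pseries >-> Funclass.

Section Antidiagonal.
Implicit Types (m a b : {cmonom nat}).

Definition antidiag m : set ({cmonom nat} * {cmonom nat}) :=
  [set ab | (ab.1 * ab.2)%M = m].

Lemma cm_le_mdeg m i : (m i <= mdeg m)%N.
Proof.
rewrite mdegE; case: mdomP => // im.
by rewrite (big_fsetD1 i) //= leq_addr.
Qed.

Lemma finite_mdvd m : finite_set [set a | exists b, (a * b)%M = m].
Proof.
pose h (u : {ffun finsupp m -> 'I_(mdeg m).+1}) : {cmonom nat} :=
  [cmonom u i : nat | i : finsupp m]%M.
apply: (@sub_finite_set _ _ (h @` [set: {ffun finsupp m -> 'I_(mdeg m).+1}])).
  move=> a /= [b abm].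
  have am i : (a i <= m i)%N by rewrite -abm cmM leq_addr.
  exists [ffun i => inord (a (val i))] => //.
  apply/eqP/cmP => i; rewrite /h cmE fsfun_ffun.
  case: insubP => [[j jm] /= _ <-|].
    by rewrite ffunE inordK // ltnS (leq_trans (am _)) ?cm_le_mdeg.
  rewrite -cmE_eq0 => /eqP mi0.
  by apply/esym/eqP; move: (am i); rewrite mi0 leqn0.
exact/finite_image/finite_finset.
Qed.

Definition mdvds m : {fset {cmonom nat}} :=
  fset_set [set a | exists b, (a * b)%M = m].

Lemma mem_mdvds m a : reflect (exists b, (a * b)%M = m) (a \in mdvds m).
Proof.
rewrite in_fset_set; last exact: finite_mdvd.
by apply: (iffP idP) => [/set_mem //|?]; apply/mem_set.
Qed.

Lemma antidiag_sub m : antidiag m `<=` [set` mdvds m] `*` [set` mdvds m].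
Proof.
move=> [a b] /= abm; split => /=; apply/mem_mdvds; first by exists b.
by exists a; rewrite mulmC.
Qed.

Lemma finite_antidiag m : finite_set (antidiag m).
Proof. exact: sub_finite_set (@antidiag_sub m) (finite_setX _ _). Qed.

End Antidiagonal.

Section PowerSeries.
Variable R : comNzRingType.
Implicit Types (f g h : pseries R) (m : {cmonom nat}) (c : R).

Lemma psP f g : (forall m, f m = g m) -> f = g.
Proof. by case: f g => [f] [g] /= /funext ->. Qed.

HB.instance Definition _ := gen_eqMixin (pseries R).
HB.instance Definition _ := gen_choiceMixin (pseries R).

Definition pszero : pseries R := PSeries (fun=> 0).
Definition psopp f := PSeries (fun m => - f m).
Definition psadd f g := PSeries (fun m => f m + g m).
Definition psone : pseries R := PSeries (fun m => (m == 1%M)%:R).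
Definition psmul f g :=
  PSeries (fun m => \sum_(ab \in antidiag m) f ab.1 * g ab.2).
Definition psscale c f := PSeries (fun m => c * f m).

Lemma psaddA : associative psadd.
Proof. by move=> f g h; apply: psP => m; exact: addrA. Qed.
Lemma psaddC : commutative psadd.
Proof. by move=> f g; apply: psP => m; exact: addrC. Qed.
Lemma psadd0 : left_id pszero psadd.
Proof. by move=> f; apply: psP => m; exact: add0r. Qed.
Lemma psaddN : left_inverse pszero psopp psadd.
Proof. by move=> f; apply: psP => m; exact: addNr. Qed.

HB.instance Definition _ :=
  GRing.isZmodule.Build (pseries R) psaddA psaddC psadd0 psaddN.

Lemma psmulEw (D : {fset {cmonom nat}}) f g m :
    antidiag m `<=` [set` D] `*` [set` D] ->
  psmul f g m = \sum_(a <- D) \sum_(b <- D | (a * b)%M == m) f a * g b.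
Proof.
move=> mD; transitivity
  (\sum_(ab \in [set` D] `*` [set` D])
     if (ab.1 * ab.2)%M == m then f ab.1 * g ab.2 else 0).
  rewrite -(@fsbig_widen _ _ _ _ (antidiag m)) //.
    by apply: eq_fsbigr => ab /set_mem /= ->; rewrite eqxx.
  by move=> ab [_ /=]; case: eqP.
rewrite -(pair_fsbig _ (fun a b => if (a * b)%M == m then f a * g b else 0)) //.
rewrite -fsbig_seq ?fset_uniq //; apply: eq_bigr => a _.
by rewrite -fsbig_seq ?fset_uniq // -big_mkcond.
Qed.

Lemma psmulE f g m : psmul f g m =
  \sum_(a <- mdvds m) \sum_(b <- mdvds m | (a * b)%M == m) f a * g b.
Proof. exact/psmulEw/antidiag_sub. Qed.

Lemma mdvds_trans m u : u \in mdvds m -> {subset mdvds u <= mdvds m}.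
Proof.
move=> /mem_mdvds[b <-] a /mem_mdvds[c <-]; apply/mem_mdvds.
by exists (c * b)%M; rewrite mulmA.
Qed.

Lemma psmulEin f g m u : u \in mdvds m -> psmul f g u =
  \sum_(a <- mdvds m) \sum_(b <- mdvds m | (a * b)%M == u) f a * g b.
Proof.
move=> um; apply: psmulEw => ab /antidiag_sub[/= a_u b_u].
by split; exact: mdvds_trans um _ _.
Qed.

Lemma psmulC : commutative psmul.
Proof.
move=> f g; apply: psP => m; rewrite !psmulE.
under eq_bigr do rewrite big_mkcond.
rewrite exchange_big; apply: eq_bigr => a _; rewrite -big_mkcond.
by apply: eq_big => [b|b _]; [rewrite mulmC | exact: mulrC].
Qed.

Lemma psmulA : associative psmul.
Proof.
suff trE f g h m : psmul f (psmul g h) m =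
    \sum_(a <- mdvds m) \sum_(b <- mdvds m) \sum_(c <- mdvds m)
      (if (a * (b * c))%M == m then f a * (g b * h c) else 0).
  move=> f g h; apply: psP => m; rewrite [psmul (psmul f g) h]psmulC !trE.
  rewrite [RHS]exchange_big; apply: eq_bigr => a _.
  rewrite [RHS]exchange_big; apply: eq_bigr => b _; apply: eq_bigr => c _.
  rewrite mulmA [(c * _)%M]mulmC.
  by case: ifP => // _; rewrite mulrA [RHS]mulrC.
rewrite psmulE; apply: eq_bigr => a _.
transitivity (\sum_(u <- mdvds m | (a * u)%M == m) \sum_(b <- mdvds m)
   \sum_(c <- mdvds m) if (b * c)%M == u then f a * (g b * h c) else 0).
  rewrite big_seq_cond [RHS]big_seq_cond.
  apply: eq_bigr => u /andP[um _]; rewrite (psmulEin _ _ um) mulr_sumr.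
  by apply: eq_bigr => b _; rewrite mulr_sumr big_mkcond.
rewrite exchange_big; apply: eq_bigr => b _.
rewrite exchange_big; apply: eq_bigr => c _.
case: ifP => [/eqP abc|abc]; last first.
  by rewrite big1 // => u /eqP au; case: eqP => // bcu; rewrite bcu au eqxx in abc.
have bcm : (b * c)%M \in mdvds m.
  by apply/mem_mdvds; exists a; rewrite mulmC.
rewrite big_mkcond (bigD1_seq _ bcm) ?fset_uniq //= abc !eqxx big1 ?addr0 //.
by move=> u ubc; case: ifP => // _; rewrite eq_sym (negPf ubc).
Qed.

Lemma psmul1 : left_id psone psmul.
Proof.
move=> f; apply: psP => m; rewrite psmulE.
have m1 : (1%M : {cmonom nat}) \in mdvds m.
  by apply/mem_mdvds; exists m; rewrite mul1m.
have mm : m \in mdvds m by apply/mem_mdvds; exists 1%M; rewrite mulm1.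
rewrite (bigD1_seq _ m1) ?fset_uniq //= [X in _ + X]big1 ?addr0.
  rewrite big_mkcond (bigD1_seq _ mm) ?fset_uniq //= mul1m !eqxx mul1r.
  by rewrite big1 ?addr0 // => b bm; rewrite mul1m (negPf bm).
by move=> a a1; rewrite big1 // => b _; rewrite (negPf a1) mul0r.
Qed.

Lemma psmulDl : left_distributive psmul psadd.
Proof.
move=> f g h; apply: psP => m.
rewrite -[RHS]/(psmul f h m + psmul g h m) !psmulE -big_split.
apply: eq_bigr => a _; rewrite -big_split.
by apply: eq_bigr => b _; exact: mulrDl.
Qed.

Lemma psone_neq0 : psone != 0.
Proof.
apply/eqP => /(congr1 (fun f : pseries R => f 1%M)) /=.
by rewrite eqxx => /eqP; rewrite oner_eq0.
Qed.

HB.instance Definition _ := GRing.Zmodule_isComNzRing.Build (pseries R)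
  psmulA psmulC psmul1 psmulDl psone_neq0.

Lemma psscaleA a b f : psscale a (psscale b f) = psscale (a * b) f.
Proof. by apply: psP => m; exact: mulrA. Qed.
Lemma psscale1 : left_id 1 psscale.
Proof. by move=> f; apply: psP => m; exact: mul1r. Qed.
Lemma psscaleDr : right_distributive psscale +%R.
Proof. by move=> c f g; apply: psP => m; exact: mulrDr. Qed.
Lemma psscaleDl f : {morph psscale^~ f : a b / a + b}.
Proof. by move=> a b; apply: psP => m; exact: mulrDl. Qed.

HB.instance Definition _ := GRing.Zmodule_isLmodule.Build R (pseries R)
  psscaleA psscale1 psscaleDr psscaleDl.

Lemma psscaleAl c f g : c *: (f * g) = c *: f * g.
Proof.
apply: psP => m.
rewrite -[LHS]/(c * psmul f g m) -[RHS]/(psmul (psscale c f) g m) !psmulE.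
rewrite mulr_sumr; apply: eq_bigr => a _; rewrite mulr_sumr.
by apply: eq_bigr => b _; exact: mulrA.
Qed.

HB.instance Definition _ :=
  GRing.Lmodule_isLalgebra.Build R (pseries R) psscaleAl.
HB.instance Definition _ :=
  GRing.Lalgebra_isComAlgebra.Build R (pseries R).

End PowerSeries.

(* m' = m \o s says that the permutation s^-1 of the variables carries the  *)
(* monomial m to m'.                                                        *)
Definition ps_symmetric (R : Type) (f : pseries R) : Prop :=
  forall s : nat -> nat, bijective s ->
  forall m m' : {cmonom nat}, (forall i, m' i = m (s i)) -> f m' = f m.

Definition ps_bounded (R : nmodType) (f : pseries R) : Prop :=
  exists d : nat, forall m : {cmonom nat}, (d < mdeg m)%N -> f m = 0.

Section MonomialPermutation.
Variables s t : nat -> nat.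
Hypotheses (sK : cancel s t) (tK : cancel t s).
Implicit Types m a b : {cmonom nat}.

Definition mperm m : {cmonom nat} := [cmonom m (s i) | i in t @` finsupp m]%M.

Lemma mpermE m i : mperm m i = m (s i).
Proof.
rewrite cmE fsfun_fun; case: ifP => // /negbT it; apply/esym/eqP.
rewrite cmE_eq0; apply: contra it => im; apply/imfsetP.
by exists (s i); rewrite ?sK.
Qed.

Lemma mpermP m m' : (forall i, m' i = m (s i)) <-> m' = mperm m.
Proof.
split=> [mm'|-> i]; last exact: mpermE.
by apply/eqP/cmP => i; rewrite mm' mpermE.
Qed.

Lemma mpermM a b : mperm (a * b)%M = (mperm a * mperm b)%M.
Proof. by apply/eqP/cmP => i; rewrite cmM !mpermE cmM. Qed.

Lemma mperm1 : mperm 1%M = 1%M.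
Proof. by apply/eqP/cmP => i; rewrite mpermE !cm1. Qed.

Lemma mperm_inj : injective mperm.
Proof.
move=> a b ab; apply/eqP/cmP => i.
by rewrite -(tK i) -!mpermE ab.
Qed.

Lemma finsupp_mperm m : finsupp (mperm m) = (t @` finsupp m)%fset.
Proof.
apply/fsetP => i; rewrite -cmE_neq0 mpermE cmE_neq0.
apply/idP/imfsetP => [im|[j /= jm ->]]; last by rewrite tK.
by exists (s i); rewrite ?sK.
Qed.

Lemma mdeg_mperm m : mdeg (mperm m) = mdeg m.
Proof.
rewrite !mdegE finsupp_mperm big_imfset /=; last by move=> ? ? _ _ /(can_inj tK).
by apply: eq_bigr => i _; rewrite mpermE tK.
Qed.

End MonomialPermutation.

Section SymmetricFunctions.
Variable R : comNzRingType.
Implicit Types (f g : pseries R) (m : {cmonom nat}).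

Definition symfun_pred : {pred pseries R} :=
  fun f => `[< ps_bounded f /\ ps_symmetric f >].

Lemma symfun_closed : GRing.subalg_closed symfun_pred.
Proof.
split=> [|c f g /asboolP[[d fd] fs] /asboolP[[e ge] gs]|f g].
- apply/asboolP; split=> [|s [t sK tK] m m' /(mpermP sK) ->].
    by exists 0%N => m; rewrite lt0n mdeg_eq0 /= => /negPf ->.
  by rewrite /= -{1}(mperm1 sK) (inj_eq (mperm_inj sK tK)).
- apply/asboolP; split=> [|s sb m m' mm'].
    exists (maxn d e) => m; rewrite gtn_max => /andP[dm em] /=.
    by rewrite fd // ge // mulr0 addr0.
  by rewrite /= (fs s sb m m') // (gs s sb m m').
move=> /asboolP[[d fd] fs] /asboolP[[e ge] gs].
apply/asboolP; split=> [|s sb m m' mm'].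
  exists (d + e)%N => m dem /=; apply: fsbig1 => -[a b] /= abm.
  have [ad|/fd->] := leqP (mdeg a) d; last by rewrite mul0r.
  have [be|/ge->] := leqP (mdeg b) e; last by rewrite mulr0.
  by move: dem; rewrite -abm mdegM ltnNge leq_add.
have [t sK tK] := sb; move/(mpermP sK): mm' => -> /=.
rewrite (reindex_fsbig (fun ab => (mperm s t ab.1, mperm s t ab.2))
  (antidiag m)) /=.
  apply: eq_fsbigr => -[a b] _ /=.
  by rewrite (fs s sb a) 1?(gs s sb b) // => i; exact: mpermE.
have mpermK m1 : mperm s t (mperm t s m1) = m1.
  by apply/eqP/cmP => i; rewrite !mpermE // sK.
split=> [[a b] /= <-|[a b] [a' b'] _ _ /= [] aa' bb'|[a b] /= abm].
- by rewrite mpermM.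
- by rewrite (mperm_inj sK tK aa') (mperm_inj sK tK bb').
- exists (mperm t s a, mperm t s b) => /=; last by rewrite !mpermK.
  by apply: (mperm_inj sK tK); rewrite mpermM // !mpermK.
Qed.

HB.instance Definition _ :=
  GRing.isSubalgClosed.Build R (pseries R) symfun_pred symfun_closed.

Record symfun := Symfun { symfun_val : pseries R;
                          symfunP : symfun_val \in symfun_pred }.

HB.instance Definition _ := [isSub for symfun_val].
HB.instance Definition _ := [Choice of symfun by <:].
HB.instance Definition _ := [SubChoice_isSubAlgebra of symfun by <:].
HB.instance Definition _ := [SubNzRing_isSubComNzRing of symfun by <:].

Lemma symfun_valM : {morph symfun_val : x y / x * y}.
Proof. exact: (rmorphM (val : symfun -> pseries R)). Qed.
Lemma symfun_val1 : symfun_val 1 = 1.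
Proof. exact: (rmorph1 (val : symfun -> pseries R)). Qed.
Lemma symfun_valD : {morph symfun_val : x y / x + y}.
Proof. exact: (raddfD (val : symfun -> pseries R)). Qed.
Lemma symfun_val0 : symfun_val 0 = 0.
Proof. exact: (raddf0 (val : symfun -> pseries R)). Qed.
Lemma symfun_valB : {morph symfun_val : x y / x - y}.
Proof. exact: (raddfB (val : symfun -> pseries R)). Qed.
Lemma symfun_valZ c : {morph symfun_val : x / c *: x}.
Proof. exact: (linearZZ (val : symfun -> pseries R)). Qed.
Lemma symfun_valX n : {morph symfun_val : x / x ^+ n}.
Proof. exact: (rmorphXn (val : symfun -> pseries R)). Qed.

End SymmetricFunctions.

Arguments symfun_pred {R}.

Definition pselem (R : comNzRingType) (k : nat) : pseries R :=
  PSeries (fun m => ((mdeg m == k) && all (fun i => m i == 1%N) (finsupp m))%:R).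

Lemma pselem_symfun (R : comNzRingType) k : pselem R k \in symfun_pred.
Proof.
apply/asboolP; split=> [|s [t sK tK] m m' /(mpermP sK) ->].
  by exists k => m km /=; rewrite gtn_eqF.
rewrite /= mdeg_mperm // finsupp_mperm //; congr (_ && _)%:R.
apply/allP/allP => [h i im|h i /imfsetP[j /= jm ->]].
  have := h (t i); rewrite mpermE // tK; apply.
  by apply/imfsetP; exists i.
by rewrite mpermE // tK h.
Qed.

Definition elemsym (R : comNzRingType) (k : nat) : symfun R :=
  Symfun (pselem_symfun R k).

Lemma elemsym0 (R : comNzRingType) : elemsym R 0 = 1.
Proof.
apply: val_inj; apply: psP => m; rewrite /= mdeg_eq0.
by case: eqP => //= ->; rewrite mdom1.
Qed.

(* l : {cmonom nat} encodes the product of the e_(i+1) ^ (l i)              *)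
Definition emon (R : comNzRingType) (l : {cmonom nat}) : symfun R :=
  \prod_(i <- finsupp l) elemsym R i.+1 ^+ l i.

Section ElementaryMonomials.
Variable R : comNzRingType.

Lemma emonEw (D : {fset nat}) (l : {cmonom nat}) :
  (finsupp l `<=` D)%fset -> emon R l = \prod_(i <- D) elemsym R i.+1 ^+ l i.
Proof.
move=> lD; rewrite /emon (big_fset_incl _ lD) // => i _.
by rewrite -cmE_eq0 => /eqP ->; rewrite expr0.
Qed.

Lemma emon_mmorphism : mmorphism (emon R).
Proof.
split=> [a b|]; last by rewrite /emon mdom1 big_seq_fset0.
rewrite (@emonEw (finsupp (a * b)%M)) // (@emonEw (finsupp (a * b)%M) a);
  last by rewrite mdomD fsubsetUl.
rewrite (@emonEw (finsupp (a * b)%M) b); last by rewrite mdomD fsubsetUr.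
by rewrite -big_split; apply: eq_bigr => i _ /=; rewrite cmM exprD.
Qed.

HB.instance Definition _ :=
  isMultiplicative.Build {cmonom nat} (symfun R) (emon R) emon_mmorphism.

Definition epoly (p : {malg R[{cmonom nat}]}) : symfun R :=
  mmap (GRing.in_alg (symfun R)) (emon R) p.

Lemma epolyE p : epoly p = \sum_(l <- msupp p) p@_l *: emon R l.
Proof. by apply: eq_bigr => l _; rewrite mulr_algl. Qed.

End ElementaryMonomials.

(* epoly is shown to be bijective by comparing leading monomials for the    *)
(* lexicographic order mlt: the one of emon l is the partition mdom l       *)
(* whose conjugate has l i parts equal to i+1.                              *)
Section LexOrder.
Implicit Types (a b c m : {cmonom nat}).

Definition mlt a b : Prop :=
  exists i, (a i < b i)%N /\ forall j, (j < i)%N -> a j = b j.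

Lemma mlt_irr a : ~ mlt a a.
Proof. by case=> i []; rewrite ltnn. Qed.

Lemma mlt_trans b a c : mlt a b -> mlt b c -> mlt a c.
Proof.
move=> [i [abi abj]] [k [bck bcj]].
have [ik|ki|ik] := ltngtP i k.
- exists i; split=> [|j ji]; first by rewrite -bcj.
  by rewrite abj // bcj // (ltn_trans ji).
- exists k; split=> [|j jk]; first by rewrite abj.
  by rewrite abj ?bcj // (ltn_trans jk).
- subst k; exists i; split=> [|j ji]; first exact: ltn_trans bck.
  by rewrite abj // bcj.
Qed.

Lemma mlt_total a b : a != b -> mlt a b \/ mlt b a.
Proof.
move=> ab; have ex : exists i, a i != b i.
  apply: contrapT => nex; move/eqP: ab; apply; apply/eqP/cmP => i.
  by apply/eqP; apply: contrapT => /negP abi; apply: nex; exists i.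
case: (ex_minnP ex) => i abi imin.
have eqj j : (j < i)%N -> a j = b j.
  move=> ji; apply/eqP; apply: contraTT ji => /imin; by rewrite leqNgt.
case: (ltngtP (a i) (b i)) abi => // abi _; [left|right]; exists i; split=> // j.
by move=> /eqj.
Qed.

Lemma mlt_mull a b c : mlt a b -> mlt (a * c)%M (b * c)%M.
Proof.
move=> [i [abi abj]]; exists i; split=> [|j ji]; rewrite !cmM ?ltn_add2r //.
by rewrite abj.
Qed.

Lemma mlt_mulr a b c : mlt a b -> mlt (c * a)%M (c * b)%M.
Proof. by rewrite ![(c * _)%M]mulmC; exact: mlt_mull. Qed.

Lemma mlt_max (s : seq {cmonom nat}) : s != [::] ->
  exists2 a, a \in s & forall b, b \in s -> b != a -> mlt b a.
Proof.
elim: s => // a s IHs _.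
have [->|s0] := eqVneq s [::].
  by exists a => [|b]; rewrite ?mem_head // inE => /eqP ->; rewrite eqxx.
have [c cs cmax] := IHs s0.
have [ac|ac] := eqVneq a c.
  by exists c => [|d]; rewrite !inE ?cs ?orbT // ac => /orP[->//|]; exact: cmax.
have [lac|lca] := mlt_total ac.
  exists c => [|d]; rewrite !inE ?cs ?orbT // => /orP[/eqP-> //|]; exact: cmax.
exists a => [|d]; rewrite !inE ?eqxx // => /orP[->//|ds _].
have [->//|dc] := eqVneq d c.
exact: mlt_trans (cmax d ds dc) lca.
Qed.

End LexOrder.

Section Leading.
Variable R : comNzRingType.
Implicit Types (f g : pseries R) (a b m : {cmonom nat}).

(* a is the largest monomial of f, and has coefficient 1                    *)
Definition lead f a : Prop := f a = 1 /\ forall b, mlt a b -> f b = 0.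

Definition pshomog d f : Prop := forall m, mdeg m != d -> f m = 0.

Lemma lead1 : lead 1 1%M.
Proof.
split=> [|b b1]; rewrite /= ?eqxx //.
by case: eqP b1 => // -> /mlt_irr.
Qed.

Lemma leadM f g a b : lead f a -> lead g b -> lead (f * g) (a * b)%M.
Proof.
move=> [fa fb] [ga gb].
have term u v c : (u * v)%M = c -> (c = (a * b)%M -> (u, v) <> (a, b)) ->
    (c = (a * b)%M \/ mlt (a * b)%M c) -> f u * g v = 0.
  move=> uvc nab abc.
  have [ua|ua] := eqVneq u a; last first.
    have [lua|lau] := mlt_total ua; last by rewrite fb // mul0r.
    have [vb|vb] := eqVneq v b.
      have lab : mlt (u * v)%M (a * b)%M by rewrite vb; exact: mlt_mull.
      rewrite uvc in lab; case: abc => [cab|cab].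
        by rewrite cab in lab; case: (mlt_irr lab).
      by case: (@mlt_irr c); exact: mlt_trans lab cab.
    have [lvb|lbv] := mlt_total vb; last by rewrite gb // mulr0.
    have lab : mlt (u * v)%M (a * b)%M.
      by apply: mlt_trans (mlt_mull _ lua) _; exact: mlt_mulr.
    rewrite uvc in lab; case: abc => [cab|cab].
      by rewrite cab in lab; case: (mlt_irr lab).
    by case: (@mlt_irr c); exact: mlt_trans lab cab.
  have [vb|vb] := eqVneq v b.
    case: abc => [/nab|]; first by rewrite ua vb.
    by rewrite -uvc ua vb => /mlt_irr.
  have [lvb|lbv] := mlt_total vb; last by rewrite gb // mulr0.
  have lab : mlt (u * v)%M (a * b)%M by rewrite ua; exact: mlt_mulr.
  rewrite uvc in lab; case: abc => [cab|cab].
    by rewrite cab in lab; case: (mlt_irr lab).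
  by case: (@mlt_irr c); exact: mlt_trans lab cab.
split=> [|c abc]; last first.
  apply: fsbig1 => -[u v] /= uvc; apply: (term u v c) => //; last by right.
  by move=> cab; rewrite cab in abc; case: (mlt_irr abc).
rewrite -[LHS]/(\sum_(uv \in antidiag (a * b)%M) f uv.1 * g uv.2).
rewrite (fsbigD1 (a, b)) ?fa ?ga ?mulr1 //=; last exact: finite_antidiag.
rewrite fsbig1 ?addr0 // => -[u v] [/= uvab uv].
by apply: (term u v _ uvab) => //; left.
Qed.

Lemma pshomog1 : pshomog 0 1.
Proof. by move=> m; rewrite mdeg_eq0 /= => /negPf ->. Qed.

Lemma pshomogM d e f g : pshomog d f -> pshomog e g -> pshomog (d + e) (f * g).
Proof.
move=> fd ge m mde; apply: fsbig1 => -[a b] /= abm.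
have [ad|/fd->] := eqVneq (mdeg a) d; last by rewrite mul0r.
have [be|/ge->] := eqVneq (mdeg b) e; last by rewrite mulr0.
by move: mde; rewrite -abm mdegM ad be eqxx.
Qed.

(* the monomial x_0 * ... * x_(k-1)                                         *)
Definition melem k : {cmonom nat} := (\big[mmul/1%M]_(i < k) ucm (i : nat)).

Lemma melemE k i : melem k i = (i < k)%N.
Proof.
rewrite /melem.
rewrite (big_morph (fun m : {cmonom nat} => m i) (cmM i) (cm1 i)).
under eq_bigr => j _ do rewrite cmU.
case: ltnP => ik.
  rewrite (bigD1 (Ordinal ik)) //= eqxx big1 // => j.
  by rewrite -val_eqE /= => /negPf ->.
by rewrite big1 // => j _; rewrite ltn_eqF // (leq_trans (ltn_ord j)).
Qed.

Lemma mdeg_melem k : mdeg (melem k) = k.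
Proof.
by rewrite mdeg_prod; under eq_bigr do rewrite mdegU; rewrite sum1_card card_ord.
Qed.

Lemma leq_sum_mdeg m (s : seq nat) : uniq s -> (\sum_(i <- s) m i <= mdeg m)%N.
Proof.
move=> us; rewrite (@mdegEw _ m (finsupp m `|` [fset i in s])%fset) ?fsubsetUl //.
rewrite [leqRHS](perm_big (s ++ [seq i <- (finsupp m `|` [fset i in s])%fset | i \notin s])).
  by rewrite big_cat leq_addr.
apply: uniq_perm; rewrite ?fset_uniq //.
  rewrite cat_uniq us filter_uniq ?fset_uniq // andbT.
  by apply/hasPn => i; rewrite mem_filter => /andP[].
move=> i; rewrite mem_cat mem_filter !inE.
by case: (i \in s); rewrite ?orbT ?orbF.
Qed.

Lemma lead_pselem k : lead (pselem R k) (melem k).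
Proof.
split=> [|b [i [mbi mbj]]] /=.
  rewrite mdeg_melem eqxx; case: (boolP (all _ _)) => // /allPn[i].
  by rewrite -cmE_neq0 melemE; case: ltnP.
case: eqP => //= bk; case: (boolP (all _ _)) => // /allP b1.
have bi1 : b i = 1%N.
  apply/eqP/b1; rewrite -cmE_neq0 -lt0n; exact: leq_ltn_trans mbi.
have ki : (k <= i)%N by rewrite leqNgt; move: mbi; rewrite melemE bi1; case: (i < k)%N.
have := @leq_sum_mdeg b (i :: iota 0 k).
rewrite /= mem_iota ltnNge ki iota_uniq => /(_ isT).
rewrite big_cons bi1 (_ : \sum_(j <- _) _ = k)%N ?bk ?ltnn //.
rewrite -[RHS](size_iota 0) -sum1_size; apply: eq_big_seq => j.
rewrite mem_iota add0n => /andP[_ jk].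
by rewrite -mbj ?melemE ?jk // (leq_trans jk).
Qed.

Lemma pshomog_pselem k : pshomog k (pselem R k).
Proof. by move=> m /negPf /= ->. Qed.

Definition mdom l : {cmonom nat} :=
  \big[mmul/1%M]_(i <- finsupp (l : {cmonom nat})) \big[mmul/1%M]_(j < l i) melem i.+1.

Lemma lead_emon l : lead (symfun_val (emon R l)) (mdom l).
Proof.
rewrite /emon (big_morph _ (@symfun_valM R) (symfun_val1 R)) /mdom.
apply: (big_ind2 lead); first exact: lead1.
  by move=> f a g b; exact: leadM.
move=> i _; rewrite symfun_valX; elim: (l i) => [|n IHn].
  by rewrite big_ord0; exact: lead1.
by rewrite exprS big_ord_recl; apply: leadM => //; exact: lead_pselem.
Qed.

Lemma pshomog_emon l : pshomog (mdeg (mdom l)) (symfun_val (emon R l)).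
Proof.
rewrite /emon (big_morph _ (@symfun_valM R) (symfun_val1 R)) mdeg_prod.
apply: (big_ind2 (fun f d => pshomog d f)); first exact: pshomog1.
  by move=> f d g e; exact: pshomogM.
move=> i _; rewrite mdeg_prod symfun_valX; elim: (l i) => [|n IHn].
  by rewrite big_ord0; exact: pshomog1.
rewrite exprS big_ord_recl; apply: pshomogM => //.
by rewrite mdeg_melem; exact: pshomog_pselem.
Qed.

Lemma mdomE l j : mdom l j = (\sum_(i <- finsupp l | j <= i) l i)%N.
Proof.
rewrite /mdom (big_morph (fun m : {cmonom nat} => m j) (cmM j) (cm1 j)).
rewrite [RHS]big_mkcond; apply: eq_bigr => i _.
rewrite (big_morph (fun m : {cmonom nat} => m j) (cmM j) (cm1 j)).
under eq_bigr do rewrite melemE ltnS.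
by rewrite sum_nat_const card_ord; case: leqP; rewrite ?muln1 ?muln0.
Qed.

Lemma mdomS l j : mdom l j = (l j + mdom l j.+1)%N.
Proof.
rewrite !mdomE; case: (mdomP l j) => lj.
  rewrite big_mkcond (bigD1_seq j) ?fset_uniq //= leqnn; congr addn.
  rewrite -big_mkcondr; apply: eq_bigl => i.
  by rewrite [RHS]ltn_neqAle eq_sym.
rewrite add0n big_seq_cond [RHS]big_seq_cond; apply: eq_bigl => i.
case il : (i \in _) => //=; rewrite [in RHS]ltn_neqAle.
by case: eqVneq => // ji; rewrite ji il in lj.
Qed.

Lemma mdom_inj : injective mdom.
Proof.
move=> k l kl; apply/eqP/cmP => i; apply: (@addIn (mdom k i.+1)).
by rewrite -mdomS [in LHS]kl [in RHS]kl -mdomS.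
Qed.

Definition mnoninc m : Prop := forall i j, (i <= j)%N -> (m j <= m i)%N.

Lemma mnoninc_ge m j : mnoninc m -> (mdeg m <= j)%N -> m j = 0%N.
Proof.
move=> mn mj; apply: contraTeq mj => mj0; rewrite -ltnNge.
apply: leq_trans (@leq_sum_mdeg m (iota 0 j.+1) (iota_uniq _ _)).
rewrite -[leqLHS](size_iota 0) -sum1_size big_seq [leqRHS]big_seq.
apply: leq_sum => i; rewrite mem_iota ltnS => /andP[_ ij].
by apply: leq_trans (mn i j ij); rewrite lt0n.
Qed.

Lemma mdom_surj m : mnoninc m -> exists l, mdom l = m.
Proof.
move=> mn; pose l : {cmonom nat} := [cmonom m i - m i.+1 | i in finsupp m]%M.
have lE i : l i = (m i - m i.+1)%N.
  by rewrite cmE fsfun_fun; case: mdomP.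
exists l; apply/eqP/cmP => i.
have mN j : (mdeg m <= j)%N -> m j = 0%N by exact: mnoninc_ge.
have big0 j : (mdeg m <= j)%N -> mdom l j = 0%N.
  move=> Nj; rewrite mdomE big1 // => k jk; rewrite lE mN //.
  exact: leq_trans jk.
have [k ik] : exists k, (mdeg m <= i + k)%N by exists (mdeg m); exact: leq_addl.
elim: k i ik => [|k IHk] i ik; first by rewrite big0 ?mN // -[i]addn0.
by rewrite mdomS IHk ?addSnnS // lE subnK // mn.
Qed.

End Leading.

Lemma mnoninc_sort (m : {cmonom nat}) :
    exists (m' : {cmonom nat}) (s : nat -> nat),
  [/\ bijective s, forall i, m' i = m (s i) & mnoninc m'].
Proof.
pose W (m : {cmonom nat}) := (\sum_(i <- finsupp m) m i * i)%N.
have WE (D : {fset nat}) (a : {cmonom nat}) : (finsupp a `<=` D)%fset ->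
    W a = (\sum_(i <- D) a i * i)%N.
  move=> aD; rewrite /W (big_fset_incl _ aD) // => i _.
  by rewrite -cmE_eq0 => /eqP ->.
have [w] := ubnP (W m); elim: w m => // w IHw m /ltnSE mw.
have [mn|] := pselect (mnoninc m).
  by exists m, id; split=> //; exists id.
move=> /existsNP[i /existsNP[j /not_implyP[ij /negP]]]; rewrite -ltnNge => mij.
have {}ij : (i < j)%N.
  by rewrite ltn_neqAle ij andbT; apply: contraTneq mij => ->; rewrite ltnn.
pose s k := if k == i then j else if k == j then i else k.
have sK : cancel s s.
  move=> k; rewrite /s; have [->|ki] := eqVneq k i.
    by rewrite eqxx; case: eqVneq ij => // ->; rewrite ltnn.
  have [->|kj] := eqVneq k j; first by rewrite eqxx.
  by rewrite (negPf ki) (negPf kj).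
have si : s i = j by rewrite /s eqxx.
have sj : s j = i by rewrite -si sK.
pose m1 := mperm s s m.
have Wm1 : (W m1 < W m)%N.
  pose D := (finsupp m `|` finsupp m1 `|` [fset i; j])%fset.
  have iD : i \in D by rewrite !inE eqxx !orbT.
  have jD : j \in D by rewrite !inE eqxx !orbT.
  have ji : j != i by rewrite gtn_eqF.
  rewrite !(WE D) ?/D -?fsetUA ?fsubsetUl //; last first.
    by rewrite fsetUCA fsubsetUl.
  rewrite fsetUA -/D !(big_fsetD1 _ iD) /=.
  have jD' : j \in (D `\ i)%fset by rewrite in_fsetD1 ji.
  rewrite !(big_fsetD1 _ jD') /= !mpermE // si sj !addnA.
  rewrite (_ : (\sum_(k <- _) m1 k * k)%N =
               (\sum_(k <- ((D `\ i) `\ j)%fset) m k * k)%N).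
    have lem (a b c d : nat) : (a < b)%N -> (c < d)%N ->
      (b * c + a * d < a * c + b * d)%N by nia.
    by rewrite ltn_add2r; exact: lem.
  apply: eq_big_seq => k; rewrite !in_fsetD1 => /and3P[kj ki _].
  by rewrite mpermE // /s (negPf kj) (negPf ki).
have [m' [t [tb m't m'n]]] := IHw m1 (leq_trans Wm1 mw).
exists m', (s \o t); split=> // [|k].
  by apply: bij_comp => //; exists s.
by rewrite m't mpermE.
Qed.

Section FundamentalTheorem.
Variable R : comNzRingType.
Implicit Types (f g : symfun R) (p q : {malg R[{cmonom nat}]}).

Lemma epolyB p q : epoly (p - q) = epoly p - epoly q.
Proof. exact: mmapB. Qed.

Lemma epolyM p q : epoly (p * q) = epoly p * epoly q.
Proof. exact: rmorphM. Qed.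

Lemma epolyZ c p : epoly (c *: p) = c *: epoly p.
Proof. by rewrite /epoly mmapZ mulr_algl. Qed.

Lemma epolyU l : epoly << l >> = emon R l.
Proof. by rewrite /epoly mmapU /= scale1r mul1r. Qed.

Lemma epoly_surj f : exists p, epoly p = f.
Proof.
have /asboolP[[d fd] _] := symfunP f.
pose top : {cmonom nat} := [cmonom d | i in [fset i in iota 0 d]]%M.
pose T := mdvds top.
have inT m : mnoninc m -> (mdeg m <= d)%N -> m \in T.
  move=> mn md; apply/mem_mdvds; exists (divcm top m).
  apply/eqP/cmP => i; rewrite cmM divcmE subnKC // cmE fsfun_fun !inE mem_iota /=.
  rewrite add0n; case: ltnP => id.
    exact: leq_trans (cm_le_mdeg _ _) md.
  by rewrite mnoninc_ge // (leq_trans md).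
pose rk m := #|` [fset x in T | `[< mlt x m >]]%fset|.
have rk_mono m m' : m \in T -> mlt m m' -> (rk m < rk m')%N.
  move=> mT mm'; apply: fproper_ltn_card; rewrite fproperE; apply/andP; split.
    apply/fsubsetP => x; rewrite !inE /= => /andP[-> /asboolP xm]; apply/asboolP.
    exact: mlt_trans xm mm'.
  apply/negP => /fsubsetP/(_ m); rewrite !inE /= mT /=.
  by move/asboolP: (mm') => -> /(_ isT) /asboolP /mlt_irr.
have [k] : exists k, forall m, mnoninc m -> symfun_val f m != 0 -> (rk m < k)%N.
  exists #|` T|.+1 => m _ _; rewrite ltnS; apply: fsubset_leq_card.
  by apply/fsubsetP => x; rewrite !inE => /andP[].
elim: k f fd => [|k IHk] f fd fk.
  exists 0; rewrite /epoly mmap0; apply: val_inj; apply: psP => m /=.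
  have [m' [s [sb m's m'n]]] := mnoninc_sort m.
  have /asboolP[_ fs] := symfunP f.
  rewrite -[LHS]/(0 : R).
  rewrite -(fs s sb m m' m's) /=; apply/eqP; apply: contrapT => /negP; rewrite eq_sym => fm'.
  by have := fk m' m'n fm'.
have [[m [mn fm rkm]]|nex] :=
    pselect (exists m, [/\ mnoninc m, symfun_val f m != 0 & rk m = k]); last first.
  apply: IHk => // m mn fm; have := fk m mn fm.
  by rewrite ltnS leq_eqVlt => /orP[/eqP rkm|//]; case: nex; exists m.
have deg_le x : symfun_val f x != 0 -> (mdeg x <= d)%N.
  by apply: contraNT; rewrite -ltnNge => /fd ->.
have [l lm] := mdom_surj mn.
pose c := symfun_val f m.
pose g := f - c *: emon R l.
have [lead_m lead_gt] := @lead_emon R l; rewrite lm in lead_m lead_gt.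
have gE x : symfun_val g x = symfun_val f x - c * symfun_val (emon R l) x.
  by rewrite /g symfun_valB symfun_valZ.
have [q gq] : exists q, epoly q = g.
  apply: IHk => [x dx|x xn].
    rewrite gE fd // (@pshomog_emon R l x) ?mulr0 ?subr0 // lm.
    by rewrite gtn_eqF // (leq_ltn_trans (deg_le m fm)).
  rewrite gE => gx; have mT : m \in T by exact/inT/deg_le.
  have [xm|xm] := eqVneq x m.
    by move: gx; rewrite xm lead_m mulr1 subrr eqxx.
  have xk : (rk x <= k)%N.
    have [fx|fx] := eqVneq (symfun_val f x) 0; last by have := fk x xn fx.
    have [|mx] := mlt_total xm; last by move: gx; rewrite fx lead_gt // mulr0 subrr eqxx.
    have [xd|dx] := leqP (mdeg x) d.
      by move=> /(rk_mono _ _ (inT _ xn xd)) /ltnW; rewrite rkm.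
    move: gx; rewrite fx (@pshomog_emon R l x) ?mulr0 ?subr0 ?eqxx // lm.
    by rewrite gtn_eqF // (leq_ltn_trans (deg_le m fm)).
  have xT : x \in T.
    apply: inT => //; rewrite leqNgt; apply: contraNN gx => dx.
    rewrite fd // (@pshomog_emon R l x) ?mulr0 ?subr0 // lm.
    by rewrite gtn_eqF // (leq_ltn_trans (deg_le m fm)).
  have [/(rk_mono _ _ xT)|mx] := mlt_total xm; first by rewrite rkm.
  by have := rk_mono _ _ mT mx; rewrite rkm ltnNge xk.
exists (q - (- c) *: << l >>).
by rewrite epolyB epolyZ epolyU gq /g scaleNr opprK subrK.
Qed.

Lemma symfun_val_sum (I : Type) (r : seq I) (P : pred I) (F : I -> symfun R) m :
  symfun_val (\sum_(i <- r | P i) F i) m = \sum_(i <- r | P i) symfun_val (F i) m.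
Proof.
apply: (big_morph (fun f : symfun R => symfun_val f m)) => [f g|].
  by rewrite symfun_valD.
by rewrite symfun_val0.
Qed.

Lemma epoly_eq0 p : epoly p = 0 -> p = 0.
Proof.
move=> p0; apply/eqP; rewrite -msupp_eq0; apply: contrapT => /negP sp.
have [|a] := @mlt_max [seq mdom l | l <- msupp p].
  by apply: contraNneq sp => /(congr1 size); rewrite size_map => /size0nil /eqP.
move=> /mapP[l lp ->] amax.
move: (congr1 (fun f : symfun R => symfun_val f (mdom l)) p0).
rewrite epolyE symfun_val_sum symfun_val0 (bigD1_seq l) ?fset_uniq //=.

have [lead_l _] := @lead_emon R l.
rewrite [_ (mdom l)]/= lead_l mulr1 big_seq_cond big1 ?addr0 => [pl|k /andP[kp kl]].
  by move: lp; rewrite -mcoeff_neq0 pl /= eqxx.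
have [_ lead_k] := @lead_emon R k.
rewrite lead_k ?mulr0 //; apply: amax; first exact: map_f.
by rewrite (inj_eq mdom_inj).
Qed.

Lemma epoly_inj : injective (@epoly R).
Proof. by move=> p q pq; apply/subr0_eq/epoly_eq0; rewrite epolyB pq subrr. Qed.

End FundamentalTheorem.

Section HDegree.
Variable R : comNzRingType.
Local Notation Lambda := (symfun R).
Implicit Types (f g : Lambda) (l : {cmonom nat}) (n m k : nat).

(* f as a polynomial in e_1, e_2, ...                                       *)
Definition ecoord f : {malg R[{cmonom nat}]} := sval (cid (epoly_surj f)).

Lemma ecoordK f : epoly (ecoord f) = f.
Proof. exact: svalP (cid (epoly_surj f)). Qed.

Lemma epolyK q : ecoord (epoly q : Lambda) = q.
Proof. by apply: epoly_inj; exact: ecoordK. Qed.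

(* the H-degree of emon l: the exponent l i is that of e_(i+1), which has   *)
(* H-degree i+2                                                             *)
Definition hdeg l : nat := (\sum_(i <- finsupp l) l i * i.+2)%N.

Definition hcomp m f : Lambda :=
  \sum_(l <- msupp (ecoord f) | hdeg l == m) (ecoord f)@_l *: emon R l.

(* v(f), with None for infinity                                             *)
Definition hval f : option nat :=
  if pselect (exists m, hcomp m f != 0) is left ex then Some (ex_minn ex)
  else None.

Definition hideal n : {pred Lambda} :=
  fun f => if hval f is Some v then (n <= v)%N else true.

Lemma hdegM : {morph hdeg : a b / (a * b)%M >-> (a + b)%N}.
Proof.
have E (D : {fset nat}) l : (finsupp l `<=` D)%fset ->
    hdeg l = (\sum_(i <- D) l i * i.+2)%N.
  move=> lD; rewrite /hdeg (big_fset_incl _ lD) // => i _.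
  by rewrite -cmE_eq0 => /eqP ->.
move=> a b; rewrite !(E (finsupp a `|` finsupp b)%fset) ?mdomD ?fsubsetUl //;
  rewrite ?fsubsetUr // -big_split.
by apply: eq_bigr => i _ /=; rewrite cmM mulnDl.
Qed.

Lemma hcomp_sum f : exists N, f = \sum_(m < N) hcomp m f.
Proof.
pose N := \max_(l <- msupp (ecoord f)) hdeg l; exists N.+1.
rewrite -{1}[f]ecoordK epolyE big_seq.
rewrite (partition_big (fun l => inord (hdeg l) : 'I_N.+1) predT) //=.
apply: eq_bigr => m _; rewrite /hcomp [RHS]big_seq_cond.
apply: eq_bigl => l; apply: andb_id2l => lf; rewrite -val_eqE /= inordK //.
by rewrite ltnS (@leq_bigmax_seq _ _ _ _ l).
Qed.

Lemma hcomp_neq0 m f :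
  reflect (exists2 l, l \in msupp (ecoord f) & hdeg l = m) (hcomp m f != 0).
Proof.
rewrite /hcomp; move: (ecoord f) => {f} P.
set h := (X in X != 0).
pose q := \sum_(l <- msupp P | hdeg l == m) << P@_l *g l >>.
have qE : epoly q = h.
  rewrite /q /h (big_morph (@epoly R) (id1 := 0) (op1 := +%R)) => [|x y|].
  - by apply: eq_bigr => l _; rewrite /epoly mmapU mulr_algl.
  - exact: mmapD.
  - exact: mmap0.
have qc l : l \in msupp P -> hdeg l = m -> q@_l = P@_l.
  move=> lf lm; rewrite /q raddf_sum /= big_mkcond (bigD1_seq l) ?fset_uniq //=.
  rewrite lm (eqxx m) big1 ?addr0; first exact: mcoeffUU.
  move=> l' l'l; case: ifP => // _.
  by rewrite (mcoeffU l' _ l) (negPf l'l) mulr0n.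
rewrite -qE; apply: (iffP idP) => [q0|[l lf lm]].
  apply: contrapT => nex; move/eqP: q0; apply; rewrite /q big_seq_cond big1.
    exact: mmap0.
  by move=> l /andP[lf /eqP lm]; case: nex; exists l.
apply/eqP => /epoly_eq0 q0; move: (lf).
by rewrite -mcoeff_neq0 -(qc l lf lm) q0 mcoeff0 eqxx.
Qed.

Lemma hidealP n f :
  reflect (forall l, l \in msupp (ecoord f) -> (n <= hdeg l)%N) (f \in hideal n).
Proof.
rewrite unfold_in /hval; case: pselect => [ex|nex]; last first.
  apply: ReflectT => l lf; case: nex; exists (hdeg l).
  by apply/hcomp_neq0; exists l.
case: ex_minnP => v hv vmin.
apply: (iffP idP) => [nv l' l'f|h]; last first.
  by have /hcomp_neq0[l lf <-] := hv; exact: h.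
by apply: leq_trans nv _; apply: vmin; apply/hcomp_neq0; exists l'.
Qed.

Lemma ecoordB f g : ecoord (f - g) = ecoord f - ecoord g.
Proof. by apply: epoly_inj; rewrite epolyB !ecoordK. Qed.

Lemma ecoordM f g : ecoord (f * g) = ecoord f * ecoord g.
Proof. by apply: epoly_inj; rewrite epolyM !ecoordK. Qed.

Lemma hideal_zmod_closed n : zmod_closed (hideal n).
Proof.
split=> [|f g /hidealP fn /hidealP gn]; apply/hidealP => l.
  have -> : ecoord 0 = 0 by apply: epoly_inj; rewrite ecoordK /epoly mmap0.
  by rewrite msupp0.
rewrite ecoordB => /(fsubsetP (msuppB_le _ _)); rewrite inE => /orP[].
  exact: fn.
exact: gn.
Qed.

HB.instance Definition _ n :=
  GRing.isZmodClosed.Build Lambda (hideal n) (hideal_zmod_closed n).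

Lemma hidealMl n f g : g \in hideal n -> f * g \in hideal n.
Proof.
move=> /hidealP gn; apply/hidealP => l.
rewrite ecoordM => /msuppM_le[a [b [_ bg ->]]].
by rewrite hdegM (leq_trans (gn b bg)) // leq_addl.
Qed.

(* The library only makes a quotient by a proper ideal into a ring, whereas *)
(* hideal 0 is the whole ring; hence the ring structure on hquot below.     *)

Section HQuotient.
Variable n : nat.
Local Open Scope quotient_scope.

Definition hquot := Quotient.quot (hideal n).

HB.instance Definition _ := GRing.Zmodule.on hquot.

Definition hred (f : Lambda) : hquot := \pi_hquot f.

Lemma hredP f g : hred f = hred g <-> f - g \in hideal n.
Proof. by rewrite Quotient.idealrBE; split=> [fg|/eqP //]; apply/eqP. Qed.

Lemma hred_repr (x : hquot) : hred (repr x) = x.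
Proof. exact: reprK. Qed.

Definition hq1 : hquot := hred 1.
Definition hqmul (x y : hquot) : hquot := hred (repr x * repr y).

Lemma hredM f g : hqmul (hred f) (hred g) = hred (f * g).
Proof.
apply/hredP; set a := repr (hred f); set b := repr (hred g).
have af : a - f \in hideal n by apply/hredP/hred_repr.
have bg : b - g \in hideal n by apply/hredP/hred_repr.
have -> : a * b - f * g = a * (b - g) + g * (a - f).
  by rewrite !mulrBr addrA [g * a]mulrC subrK [g * f]mulrC.
by rewrite rpredD // hidealMl.
Qed.

Lemma hredD f g : hred (f + g) = hred f + hred g.
Proof. exact: Quotient.pi_add. Qed.

Lemma hqmulA : associative hqmul.
Proof.
move=> x y z; rewrite -[x]hred_repr -[y]hred_repr -[z]hred_repr.
by rewrite !hredM mulrA.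
Qed.

Lemma hqmulC : commutative hqmul.
Proof. by move=> x y; rewrite /hqmul mulrC. Qed.

Lemma hqmul1 : left_id hq1 hqmul.
Proof. by move=> x; rewrite -[x]hred_repr hredM mul1r. Qed.

Lemma hqmulDl : left_distributive hqmul +%R.
Proof.
move=> x y z; rewrite -[x]hred_repr -[y]hred_repr -[z]hred_repr.
by rewrite -hredD !hredM -hredD mulrDl.
Qed.

HB.instance Definition _ :=
  GRing.Zmodule_isComPzRing.Build hquot hqmulA hqmulC hqmul1 hqmulDl.

Lemma hred_elemsym j : (n <= j)%N -> hred (elemsym R j) = 0.
Proof.
have hred0 : hred 0 = 0 by have := hredD 0 0; rewrite addr0 -{1}[hred 0]addr0 => /addrI.
move=> nj; rewrite -hred0; apply/hredP; rewrite subr0; apply/hidealP.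
case: j nj => [|j] nj l; first by rewrite (leq_trans nj).
suff -> : ecoord (elemsym R j.+1) = << ucm j >>.
  move=> /(fsubsetP msuppU_le); rewrite inE => /eqP ->.
  by rewrite /hdeg mdomU big_seq_fset1 cmUU mul1n ltnW // ltnS.
apply: epoly_inj; rewrite ecoordK epolyU.
by rewrite /emon mdomU big_seq_fset1 cmUU expr1.
Qed.

(* finitely supported sum: hred_elemsym                                     *)
Definition beta k : hquot :=
  hred (elemsym R k) +
  \sum_(j \in [set j | (k <= j)%N])
    (-1) ^+ j.+1 * 'C(j, k)%:R * hred (elemsym R j).

End HQuotient.

End HDegree.

Definition ideal_generated (A : comPzRingType) (b : nat -> A) : set A :=
  [set x | exists (N : nat) (a : nat -> A), x = \sum_(k < N) a k * b k].

Section Evaluation.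
Variable R : comNzRingType.
Implicit Types (f : symfun R) (s : seq R).

(* f(s_0, ..., s_(r-1), 0, 0, ...) for a list s of length r; the terms with *)
(* nonzero value are finitely many.                                         *)
Definition symeval f s : R :=
  \sum_(m \in [set: {cmonom nat}])
    symfun_val f m * \prod_(i <- finsupp m) s`_i ^+ m i.

Lemma symeval_finite f s :
  finite_set [set m : {cmonom nat} |
    symfun_val f m * \prod_(i <- finsupp m) s`_i ^+ m i != 0].
Proof.
have /asboolP[[d fd] _] := symfunP f.
pose top : {cmonom nat} := [cmonom d | i in [fset i in iota 0 (size s)]]%M.
apply: (sub_finite_set _ (finite_mdvd top)) => m /= /eqP m0.
exists (divcm top m); apply/eqP/cmP => i.
rewrite cmM divcmE subnKC // cmE fsfun_fun !inE mem_iota /= add0n.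
have md : (mdeg m <= d)%N.
  by rewrite leqNgt; apply/negP => /fd fm0; apply: m0; rewrite fm0 mul0r.
case: ltnP => si; first exact: leq_trans (cm_le_mdeg _ _) md.
rewrite leqn0 cmE_eq0; apply/negP => im; apply: m0.
rewrite (bigD1_seq i) ?fset_uniq //= nth_default // expr0n.
by rewrite cmE_eq0 im mul0r mulr0.
Qed.

End Evaluation.

(* The localization of the integers at p, as a subset of rat                *)
Definition Zloc (p : nat) : {pred rat} := fun x => coprime p `|denq x|.

Definition eqmod_Zloc (p n : nat) (x y : rat) : Prop :=
  exists2 z, z \in Zloc p & x - y = p%:R ^+ n * z.

(* Main.v *)
(* Put E(T) = prod_{0<i<p} (1 + (p/i) T), so that e_j(p/1, ..., p/(p-1)) is   *)
(* the coefficient of T^j in E. For p odd, the involution i -> p - i gives    *)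
(* E(-1-T) = E(T), and comparing the coefficients of T^k shows that the       *)
(* untruncated beta_k evaluates to 0. Its truncation only drops multiples of  *)
(* the e_j with j >= n, whose values lie in p^j Z_(p). Finally the value of   *)
(* e_j lies even in p^(j+1) Z_(p) when 0 < j < p-1, because                   *)
(* prod_{0<i<p} (T + i) = T^(p-1) - 1 modulo p; this is why an f of H-degree  *)
(* at least n takes values in p^n Z_(p) for p large.                          *)
From HB Require Import structures.
Require Import Defs.
From mathcomp Require Import all_boot all_order all_algebra all_field finmap.
From mathcomp Require Import boolp classical_sets functions cardinality fsbigop.
From mathcomp Require Import monalg ring zify.
Set Implicit Arguments.
Unset Strict Implicit.
Unset Printing Implicit Defensive.
Import Order.TTheory GRing.Theory Num.Theory.
Local Open Scope ring_scope.

(** Evaluation at [harmseq p], the list $p/1,\ldots,p/(p-1)$, is a ring morphism [evalat]. Lifting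
    the hypothesis from the quotient to $\Lambda$ gives $f = g + \sum_k A_k\tilde\beta_k$, where
    $g\in\mathcal{I}_n$ and $\tilde\beta_k$ is the truncated sum [beta_lift]. Two estimates then
    suffice.

    [evalat_hideal]: for large $p$ the value of $e_k$ is divisible by $p^{k+1}$
    ([coef_harmseq_pZlocS]), and $k+1$ is exactly its H-degree. Hence $g$ takes a value in
    $p^n\mathbb{Z}_{(p)}$, and, at level 0, each $A_k$ takes a value in $\mathbb{Z}_{(p)}$.

    [evalat_beta_lift]: the reflection symmetry [elempoly_harmseq_sym] makes the full alternating
    sum vanish, so $\tilde\beta_k$ evaluates to minus a tail over $j\geq n$, which lies in
    $p^n\mathbb{Z}_{(p)}$ by [coef_harmseq_pZloc].

    Only finitely many monomials and indices $k$ occur, so the finitely many lower bounds on $p$ can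
    be combined. *)

(** * Evaluation at a finite list as an algebra morphism *)

Section SymevalMorphism.
Variables (R : comNzRingType).
Implicit Types (f g : symfun R) (s : seq R) (m a b : {cmonom nat}).

Definition mev s m : R := \prod_(i <- finsupp m) s`_i ^+ m i.

Lemma mevEw s m (D : {fset nat}) : (finsupp m `<=` D)%fset ->
  mev s m = \prod_(i <- D) s`_i ^+ m i.
Proof.
move=> mD; rewrite /mev (big_fset_incl _ mD) // => i _.
by rewrite -cmE_eq0 => /eqP ->; rewrite expr0.
Qed.

Lemma mevM s a b : mev s (mmul a b) = mev s a * mev s b.
Proof.
rewrite !(@mevEw _ _ (finsupp a `|` finsupp b)%fset) ?mdomD ?fsubsetUl ?fsubsetUr //.
by rewrite -big_split; apply: eq_bigr => i _ /=; rewrite cmM exprD.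
Qed.

(** The monomial $(x_0\cdots x_{r-1})^d$. Its divisors are a finite index set containing every
    monomial of degree at most $d$ that does not vanish at a list of length $r$, so several
    evaluations can be summed over one common range. *)
Definition mbox r d : {cmonom nat} := [cmonom d | i in [fset i in iota 0 r]]%M.

Lemma mem_mbox s d m : (mdeg m <= d)%N -> mev s m != 0 ->
  m \in mdvds (mbox (size s) d).
Proof.
move=> md m0; apply/mem_mdvds; exists (divcm (mbox (size s) d) m).
apply/eqP/cmP => i.
rewrite cmM divcmE subnKC // cmE fsfun_fun !inE mem_iota /= add0n.
case: ltnP => si; first exact: leq_trans (cm_le_mdeg _ _) md.
rewrite leqn0 cmE_eq0; apply: contra m0 => im.
rewrite /mev (bigD1_seq i) ?fset_uniq //= nth_default // expr0n.
by rewrite cmE_eq0 im mul0r.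
Qed.

Lemma symevalEw f s d : (forall m, (d < mdeg m)%N -> symfun_val f m = 0) ->
  symeval f s = \sum_(m <- mdvds (mbox (size s) d)) symfun_val f m * mev s m.
Proof.
move=> fd; rewrite /symeval [RHS]fsbig_seq ?fset_uniq //; symmetry; apply: fsbig_widen => //.
move=> m [_ /= mT]; have [md|/fd->] := leqP (mdeg m) d; last by rewrite mul0r.
have [m0|m0] := eqVneq (mev s m) 0; first by rewrite -/(mev s m) m0 mulr0.
by case: mT; exact: mem_mbox.
Qed.

Lemma symfun_bounded f :
  exists d, forall m, (d < mdeg m)%N -> symfun_val f m = 0.
Proof. by have /asboolP[] := symfunP f. Qed.

(** The list comes first so that the morphism structures attach to the function of [f]. *)
Definition evalat s f : R := symeval f s.

Lemma evalat_linear s : linear (evalat s : _ -> R^o).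
Proof.
move=> c f g; have [d fd] := symfun_bounded f; have [e ge] := symfun_bounded g.
have fm m : (maxn d e < mdeg m)%N -> symfun_val f m = 0.
  by rewrite gtn_max => /andP[/fd].
have gm m : (maxn d e < mdeg m)%N -> symfun_val g m = 0.
  by rewrite gtn_max => /andP[_ /ge].
rewrite /evalat (symevalEw _ fm) (symevalEw _ gm) (@symevalEw _ s (maxn d e)).
  rewrite scaler_sumr -big_split; apply: eq_bigr => m _.
  by rewrite symfun_valD symfun_valZ /= mulrDl -mulrA.
by move=> m dm; rewrite symfun_valD symfun_valZ /= fm // gm // mulr0 addr0.
Qed.

Lemma evalat_monoid_morphism s : monoid_morphism (evalat s).
Proof.
split.
  rewrite /evalat (@symevalEw _ s 0) => [|m]; last first.
    by rewrite lt0n mdeg_eq0 symfun_val1 /= => /negPf ->.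
  rewrite (bigD1_seq mone) ?fset_uniq //=; last first.
    by apply/mem_mdvds; exists (mbox (size s) 0); rewrite mul1m.
  rewrite eqxx mul1r /mev mdom1 big_seq_fset0 big1 ?addr0 // => m.
  by move=> /negPf /= ->; rewrite mul0r.
move=> f g; have [d fd] := symfun_bounded f; have [e ge] := symfun_bounded g.
have fgde m : (d + e < mdeg m)%N -> symfun_val (f * g) m = 0.
  move=> dem; rewrite symfun_valM /=; apply: fsbig1 => -[a b] /= abm.
  have [ad|/fd->] := leqP (mdeg a) d; last by rewrite mul0r.
  have [be|/ge->] := leqP (mdeg b) e; last by rewrite mulr0.
  by move: dem; rewrite -abm mdegM ltnNge leq_add.
rewrite /evalat (symevalEw _ fgde).
rewrite (@symevalEw f s (d + e)) => [|m dem]; last first.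
  by rewrite fd // (leq_ltn_trans (leq_addr _ _) dem).
rewrite (@symevalEw g s (d + e)) => [|m dem]; last first.
  by rewrite ge // (leq_ltn_trans (leq_addl _ _) dem).
set T := mdvds _.
transitivity (\sum_(u <- T) \sum_(a <- T) \sum_(b <- T)
  if mmul a b == u then symfun_val f a * symfun_val g b * mev s u else 0).
  apply: eq_big_seq => u uT.
  rewrite symfun_valM -[_ u]/(psmul (symfun_val f) (symfun_val g) u).
  rewrite (psmulEin _ _ uT) mulr_suml; apply: eq_bigr => a _.
  by rewrite mulr_suml -big_mkcond.
rewrite exchange_big mulr_suml; apply: eq_bigr => a _.
rewrite exchange_big mulr_sumr; apply: eq_bigr => b _.
have -> : symfun_val f a * mev s a * (symfun_val g b * mev s b) =
          symfun_val f a * symfun_val g b * mev s (mmul a b).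
  by rewrite mevM mulrACA.
(* Inside the box exactly one [u] matches. Outside it none does, and the right-hand term vanishes
   too, either by degree or because the monomial has value 0. *)
have [abT|abT] := boolP (mmul a b \in T).
  rewrite (bigD1_seq _ abT) ?fset_uniq //= eqxx big1 ?addr0 // => u.
  by rewrite eq_sym => /negPf ->.
rewrite big_seq big1 => [|u uT]; last first.
  by case: eqP => // abu; rewrite abu uT in abT.
have [ad|/fd->] := leqP (mdeg a) d; last by rewrite !mul0r.
have [be|/ge->] := leqP (mdeg b) e; last by rewrite mulr0 mul0r.
have [->|ab0] := eqVneq (mev s (mmul a b)) 0; first by rewrite mulr0.
by case/negP: abT; apply: mem_mbox => //; rewrite mdegM leq_add.
Qed.

HB.instance Definition _ s :=
  GRing.isLinear.Build R (symfun R) R^o _ (evalat s) (evalat_linear s).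
HB.instance Definition _ s :=
  GRing.isMonoidMorphism.Build (symfun R) R (evalat s) (evalat_monoid_morphism s).

Lemma evalatZ s c f : evalat s (c *: f) = c * evalat s f.
Proof. exact: linearZ. Qed.

(** * Values of the elementary symmetric functions as polynomial coefficients *)

Definition elempoly s : {poly R} := \prod_(x <- s) (1 + x *: 'X).

(** Squarefree monomials in the first [r] variables, indexed by subsets: the only monomials of an
    elementary symmetric function that can survive evaluation at a list of length [r]. *)
Definition mset r (J : {set 'I_r}) : {cmonom nat} :=
  [cmonom 1%N | i in [fset i in map val (enum J)]]%M.

Lemma msetE r (J : {set 'I_r}) i : mset J i = (i \in map val (enum J)).
Proof. by rewrite cmE fsfun_fun !inE /=; case: (_ \in _). Qed.

Lemma finsupp_mset r (J : {set 'I_r}) :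
  finsupp (mset J) = [fset i in map val (enum J)]%fset.
Proof.
by apply/fsetP => i; rewrite -cmE_neq0 msetE !inE /=; case: (_ \in _).
Qed.

Lemma mset_inj r : injective (@mset r).
Proof.
move=> J K /(congr1 (fun m : {cmonom nat} => m : nat -> nat)) JK.
apply/setP => i; have := congr1 (@^~ (val i)) JK; rewrite !msetE.
by rewrite !mem_map ?mem_enum; [do 2![case: (_ \in _)] | exact: val_inj..].
Qed.

Lemma prod_mset (T : Type) (idx : T) (op : Monoid.com_law idx) r (J : {set 'I_r}) F :
  \big[op/idx]_(i <- finsupp (mset J)) F i = \big[op/idx]_(i in J) F (val i).
Proof.
rewrite finsupp_mset -[RHS]big_enum /= -(big_map val predT F).
apply: perm_big; apply: uniq_perm; rewrite ?fset_uniq //.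
  by rewrite map_inj_uniq ?enum_uniq //; exact: val_inj.
by move=> i; rewrite !inE.
Qed.

Lemma mdeg_mset r (J : {set 'I_r}) : mdeg (mset J) = #|J|.
Proof.
rewrite mdegE prod_mset -sum1_card; apply: eq_bigr => i iJ.
by rewrite msetE mem_map ?mem_enum ?iJ //; exact: val_inj.
Qed.

Lemma mev_mset s (J : {set 'I_(size s)}) :
  mev s (mset J) = \prod_(i in J) s`_i.
Proof.
rewrite /mev prod_mset; apply: eq_bigr => i iJ.
by rewrite msetE mem_map ?mem_enum ?iJ //; exact: val_inj.
Qed.

(** Expanding the product [elempoly s] by choosing the subset of factors that contribute $X$ yields
    the same sum over squarefree monomials. *)
Lemma evalat_elemsym s j : evalat s (elemsym R j) = (elempoly s)`_j.
Proof.
transitivity (\sum_(J : {set 'I_(size s)} | #|J| == j) \prod_(i in J) s`_i); last first.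
  have -> : elempoly s = \prod_(i < size s) (s`_i *: 'X + 1).
    by rewrite /elempoly (big_nth 0) big_mkord; apply: eq_bigr => i _; rewrite addrC.
  rewrite bigA_distr coef_sum big_mkcond; apply: eq_bigr => J _.
  rewrite -big_mkcond /= scaler_prod prodr_const coefZ coefXn eq_sym.
  by case: eqP; rewrite ?mulr1 ?mulr0.
pose F m := symfun_val (elemsym R j) m * mev s m.
pose D := [fset mset J | J : {set 'I_(size s)}]%fset.
transitivity (\sum_(m <- D) F m).
  rewrite /evalat /symeval [RHS]fsbig_seq ?fset_uniq //; symmetry; apply: fsbig_widen => //.
  move=> m [_ /= mD]; have [m0|m0] := eqVneq (mev s m) 0.
    by rewrite /= /F m0 mulr0.
  rewrite /= /F /=.
  case: eqP => [mj|]; last by rewrite mul0r.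
  case: allP => [m1|]; last by rewrite andbF mul0r.
  case: mD; apply/imfsetP; exists [set i : 'I_(size s) | val i \in finsupp m]%SET => //.
  apply/eqP/cmP => i; rewrite msetE.
  (* A nonzero value forces the variables of [m] to have index below [size s], so that [m] comes
     from a subset. *)
  have := mem_mbox (leqnn _) m0 => /mem_mdvds[b /eqP/cmP/(_ i)].
  rewrite cmM cmE fsfun_fun !inE mem_iota /= add0n => mi.
  have [im|im] := boolP (i \in finsupp m).
    rewrite (eqP (m1 i im)); move: mi; rewrite (eqP (m1 i im)).
    case: ltnP => // si _; apply/esym/eqP; rewrite eqb1; apply/mapP.
    by exists (Ordinal si); rewrite // mem_enum inE.
  move: (im); rewrite -cmE_eq0 => /eqP ->; apply/esym/eqP; rewrite eqb0.
  by apply: contra im => /mapP[x]; rewrite mem_enum inE => ? ->.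
rewrite big_imfset /=; last by move=> ? ? _ _; exact: mset_inj.
rewrite big_enum /= [RHS]big_mkcond; apply: eq_bigr => J _.
rewrite /F /= mdeg_mset mev_mset; case: eqP => _; last by rewrite mul0r.
case: allP => [|[]]; first by rewrite mul1r.
by move=> i; rewrite finsupp_mset !inE /= => iJ; rewrite msetE iJ.
Qed.

End SymevalMorphism.

(** * Arithmetic in $p^n\mathbb{Z}_{(p)}$ *)

Section Padic.
Variable p : nat.
Hypothesis p_pr : prime p.

(** Any denominator prime to $p$ will do, since the reduced one divides it by Gauss's lemma. The
    closure properties then avoid lowest terms. *)
Lemma ZlocP (x : rat) :
  reflect (exists (a : int) (d : nat), coprime p d /\ x * d%:R = a%:~R)
    (x \in Zloc p).
Proof.
apply: (iffP idP) => [xp|[a [d [pd xd]]]].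
  exists (numq x), `|denq x|%N; split=> //.
  by rewrite -[X in X * _]divq_num_den pmulrn absz_denq divfK // intr_eq0 denq_neq0.
rewrite unfold_in; apply: coprime_dvdr pd.
suff : (denq x %| d%:Z)%Z by [].
rewrite -(@Gauss_dvdzr _ (numq x)); last by rewrite coprimez_sym; exact: coprime_num_den.
apply/dvdzP; exists a; apply/eqP; rewrite -(eqr_int rat) !rmorphM /= -xd.
rewrite -[X in X * d%:R]divq_num_den mulrAC divfK ?intr_eq0 ?denq_neq0 //.
Qed.

Lemma Zloc_int (a : int) : a%:~R \in Zloc p.
Proof. by apply/ZlocP; exists a, 1%N; rewrite coprimen1 mulr1. Qed.

Lemma ZlocD x y : x \in Zloc p -> y \in Zloc p -> x + y \in Zloc p.
Proof.
move=> /ZlocP[a [d [pd xa]]] /ZlocP[b [e [pe yb]]]; apply/ZlocP.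
exists (a * e%:Z + b * d%:Z), (d * e)%N; split; first by rewrite coprimeMr pd.
by rewrite intrD !intrM -xa -yb natrM -!pmulrn; ring.
Qed.

Lemma ZlocM x y : x \in Zloc p -> y \in Zloc p -> x * y \in Zloc p.
Proof.
move=> /ZlocP[a [d [pd xa]]] /ZlocP[b [e [pe yb]]]; apply/ZlocP.
exists (a * b), (d * e)%N; split; first by rewrite coprimeMr pd.
by rewrite intrM -xa -yb natrM; ring.
Qed.

Lemma Zloc_divn (a : int) (d : nat) : coprime p d -> a%:~R / d%:R \in Zloc p.
Proof.
move=> pd; apply/ZlocP; exists a, d; split=> //.
rewrite divfK // pnatr_eq0; apply: contraTneq pd => ->.
by rewrite /coprime gcdn0 neq_ltn prime_gt1 ?orbT.
Qed.

Definition pZloc n (x : rat) : Prop := exists2 z, z \in Zloc p & x = p%:R ^+ n * z.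

Lemma pZloc0 n : pZloc n 0.
Proof. by exists 0; rewrite ?mulr0 // (Zloc_int 0). Qed.

Lemma pZlocD n x y : pZloc n x -> pZloc n y -> pZloc n (x + y).
Proof.
move=> [a ap ->] [b bp ->]; exists (a + b); first exact: ZlocD.
by rewrite mulrDr.
Qed.

Lemma pZlocM m n x y : pZloc m x -> pZloc n y -> pZloc (m + n) (x * y).
Proof.
move=> [a ap ->] [b bp ->]; exists (a * b); first exact: ZlocM.
by rewrite exprD mulrACA.
Qed.

Lemma pZlocW m n x : (m <= n)%N -> pZloc n x -> pZloc m x.
Proof.
move=> mn [a ap ->]; exists (p%:R ^+ (n - m) * a).
  by apply: ZlocM => //; rewrite -natrX pmulrn; exact: Zloc_int.
by rewrite mulrA -exprD subnKC.
Qed.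

Lemma pZloc_sum n (I : eqType) (r : seq I) (P : pred I) F :
  (forall i, i \in r -> P i -> pZloc n (F i)) -> pZloc n (\sum_(i <- r | P i) F i).
Proof.
move=> h; rewrite big_seq_cond; apply: big_ind => [||i /andP[]]; last exact: h.
  exact: pZloc0.
by move=> x y; exact: pZlocD.
Qed.

Lemma pZloc_int (a : int) : pZloc 0 a%:~R.
Proof. by exists a%:~R; [exact: Zloc_int | rewrite mul1r]. Qed.

Lemma pZlocX m n x : pZloc m x -> pZloc (n * m) (x ^+ n).
Proof.
move=> xm; elim: n => [|n IH]; first exact: (pZloc_int 1).
by rewrite exprS mulSn; exact: pZlocM.
Qed.

(** * The product of the $X+i$ modulo p *)

Definition risepoly : {poly int} := \prod_(1 <= i < p) ('X + i%:R%:P).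

(** Modulo $p$, $X\prod_{0<i<p}(X+i)=\prod_{x\in\mathbb{F}_p}(X-x)=X^p-X$. The excluded end
    coefficients, at $j=0$ and $j=p-1$, are $-1$ and $1$ modulo $p$. *)
Lemma dvdz_risepoly j : (0 < j < p.-1)%N -> (p %| risepoly`_j)%Z.
Proof.
move=> /andP[j0 jp].
have p0 := prime_gt0 p_pr.
suff : ((risepoly`_j)%:~R : 'F_p) = 0.
  move=> /eqP h.
  have : (`|(risepoly`_j)%R|%N%:R : 'F_p) = 0.
    by apply/eqP; move: h; case: (risepoly`_j) => k //=; rewrite NegzE mulrNz oppr_eq0.
  by move=> /eqP; rewrite -(dvdn_pcharf (pchar_Fp p_pr)).
have -> : (risepoly`_j)%:~R = (map_poly (fun x : int => x%:~R : 'F_p) risepoly)`_j.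
  by rewrite coef_map.
rewrite /risepoly rmorph_prod /=.
under eq_bigr do rewrite rmorphD /= map_polyX map_polyC /= natz -pmulrn.
set Q := \prod_(_ <= _ < _) _.
have : 'X * Q = 'X^p - 'X.
  have -> : 'X^p - 'X = \prod_(x : 'F_p) ('X - x%:P) :> {poly 'F_p}.
    by rewrite -finField_genPoly card_Fp.
  have -> : \prod_(x : 'F_p) ('X - x%:P) = \prod_(x : 'F_p) ('X + x%:P) :> {poly 'F_p}.
    rewrite (reindex_inj oppr_inj) /=; apply: eq_bigr => x _.
    by rewrite polyCN opprK.
  have -> : 'X * Q = \prod_(0 <= i < p) ('X + i%:R%:P).
    by rewrite big_ltn // polyC0 addr0.
  (* The elements of ['F_p] are ordinals whose bound is only provably equal to [p]. Generalizing
     over [n] changes the bound of the product without touching the [p] inside the type. *)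
  have widen n : n = p -> \prod_(0 <= i < p) ('X + i%:R%:P) =
      \prod_(0 <= i < n) ('X + i%:R%:P) :> {poly 'F_p} by move->.
  rewrite (widen _ (Fp_cast p_pr)) big_mkord.
  by apply: eq_bigr => x _; rewrite natr_Zp.
move=> /(congr1 (fun q : {poly 'F_p} => q`_j.+1)).
have jp' : (j.+1 == p) = false by apply/negbTE; lia.
have j1 : (j.+1 == 1%N) = false by apply/negbTE; lia.
by rewrite coefXM coefB coefXn coefX jp' j1 subrr.
Qed.

Lemma coprime_factorial m : (m < p)%N -> coprime p m`!.
Proof.
elim: m => [|m IH] mp; first by rewrite fact0 coprimen1.
rewrite factS coprimeMr IH 1?ltnW // andbT prime_coprime //.
by apply/negP => /(dvdn_leq (ltn0Sn m)); rewrite leqNgt mp.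
Qed.

(** * Elementary symmetric functions of $p/1,\ldots,p/(p-1)$ *)

Definition harmseq : seq rat := [seq p%:R / i%:R | i <- iota 1 p.-1].

Lemma elempoly_harmseqE : elempoly harmseq =
  ((p.-1)`!%:R)^-1 *: \prod_(1 <= i < p) (i%:R%:P + p%:R *: 'X).
Proof.
have -> : (p.-1)`! = (\prod_(1 <= i < p) i)%N by rewrite fact_prod prednK ?prime_gt0.
rewrite /elempoly /harmseq big_map -subn1 -/(index_iota 1 p) natr_prod -prodfV -scaler_prod.
apply: eq_big_nat => i /andP[i0 _].
have ni : i%:R != 0 :> rat by rewrite pnatr_eq0 -lt0n.
rewrite scalerDr -[i%:R%:P]mulr1 mul_polyC !scalerA mulVf // scale1r.
by rewrite [p%:R / _]mulrC.
Qed.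

Lemma coef_comp_polyZX (R : comNzRingType) (P : {poly R}) c j :
  (P \Po (c *: 'X))`_j = c ^+ j * P`_j.
Proof.
rewrite coef_comp_poly; have [jP|Pj] := ltnP j (size P).
  rewrite (bigD1 (Ordinal jP)) //= exprZn coefZ coefXn eqxx mulr1 mulrC.
  rewrite big1 ?addr0 // => i ij; rewrite exprZn coefZ coefXn.
  by rewrite eq_sym (negPf (_ : i != j :> nat)) ?mulr0.
rewrite nth_default // mulr0 big1 // => i _; rewrite exprZn coefZ coefXn.
by rewrite gtn_eqF ?mulr0 // (leq_trans _ Pj).
Qed.

(** Up to the factor $1/(p-1)!$, [elempoly harmseq] is [risepoly] with $pX$ substituted for $X$. *)
Lemma coef_elempoly_harmseq j :
  (elempoly harmseq)`_j = p%:R ^+ j * ((risepoly`_j)%:~R / ((p.-1)`!)%:R).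
Proof.
rewrite elempoly_harmseqE coefZ.
have -> : \prod_(1 <= i < p) (i%:R%:P + p%:R *: 'X) =
    map_poly (intr : int -> rat) risepoly \Po (p%:R *: 'X).
  rewrite rmorph_prod /= rmorph_prod /=; apply: eq_bigr => i _.
  by rewrite rmorphD /= map_polyX map_polyC /= natz -pmulrn comp_polyD comp_polyX comp_polyC addrC.
rewrite coef_comp_polyZX coef_map /= mulrA mulrC [in RHS]mulrCA mulrA; ring.
Qed.


(** Since $i+p(-1-X)=-((p-i)+pX)$, the substitution reverses the order of the factors, and the $p-1$
    signs cancel. *)
Lemma elempoly_harmseq_sym : odd p ->
  elempoly harmseq \Po (- 1 - 'X) = elempoly harmseq.
Proof.
move=> p_odd; have p0 := prime_gt0 p_pr.
rewrite elempoly_harmseqE comp_polyZ rmorph_prod /=; congr (_ *: _).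
transitivity (\prod_(1 <= i < p) - ((p - i)%:R%:P + p%:R *: 'X : {poly rat})).
  apply: eq_big_nat => i /andP[i0 ip].
  rewrite comp_polyD comp_polyC comp_polyZ comp_polyX natrB 1?ltnW // polyCB.
  by rewrite -!mul_polyC; ring.
rewrite big_nat_rev /= (eq_big_nat _ _ (F2 := fun i => - (i%:R%:P + p%:R *: 'X))).
  under eq_bigr do rewrite -mulN1r.
  rewrite big_split /= prodr_const_nat subn1 -signr_odd.
  have -> : odd p.-1 = false by move: p_odd; rewrite -{1}(prednK p0) /= => /negbTE.
  by rewrite mul1r.
by move=> i /andP[i0 ip]; congr (- (_%:R%:P + _)); lia.
Qed.

Lemma coef_1DXn (R : comNzRingType) n k : ((1 + 'X : {poly R}) ^+ n)`_k = 'C(n, k)%:R.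
Proof.
rewrite exprDn coef_sum; have [kn|nk] := ltnP k n.+1.
  rewrite (bigD1 (Ordinal kn)) //= expr1n mul1r coefMn coefXn eqxx.
  rewrite big1 ?addr0 // => i ik; rewrite expr1n mul1r coefMn coefXn.
  by rewrite eq_sym (negPf (_ : i != k :> nat)) ?mul0rn.
rewrite bin_small // big1 // => i _; rewrite expr1n mul1r coefMn coefXn.
by rewrite gtn_eqF ?mul0rn // (leq_trans _ nk).
Qed.

(** Compare the coefficients of $X^k$ in $E(X)=E(-1-X)=\sum_j(-1)^jE_j(1+X)^j$. The bound [N] is
    left free so that the sum can later be split at any [n]. *)
Lemma coef_elempoly_harmseq_sym N k : odd p -> (size (elempoly harmseq) <= N)%N ->
  (elempoly harmseq)`_k
    + \sum_(0 <= j < N) (-1) ^+ j.+1 * 'C(j, k)%:R * (elempoly harmseq)`_j = 0.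
Proof.
move=> p_odd EN; rewrite -[in X in X + _](elempoly_harmseq_sym p_odd).
move: (elempoly harmseq) EN => E EN.
rewrite coef_comp_poly -(big_mkord predT (fun i => E`_i * ((- 1 - 'X) ^+ i)`_k)).
rewrite [X in _ + X](big_cat_nat (leq0n _) EN) //= [X in _ + (_ + X)]big_nat_cond.
rewrite [X in _ + (_ + X)]big1 => [|j /andP[/andP[Ej _] _]]; last first.
  by rewrite nth_default ?mulr0.
rewrite addr0 -big_split big1 //= => j _.
by rewrite -opprD -scaleN1r exprZn coefZ coef_1DXn exprS; ring.
Qed.

(** Valid in every degree, as the tails of the $\beta_k$ require; it rests on $(p-1)!$ being prime
    to $p$. *)
Lemma coef_harmseq_pZloc j : pZloc j (elempoly harmseq)`_j.
Proof.
rewrite coef_elempoly_harmseq; exists ((risepoly`_j)%:~R / ((p.-1)`!)%:R) => //.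
by apply/Zloc_divn/coprime_factorial; rewrite prednK ?prime_gt0.
Qed.

(** The extra factor $p$ comes from [dvdz_risepoly]; it is what the shift from $k$ to $k+1$ in the
    H-degree records. *)
Lemma coef_harmseq_pZlocS j : (0 < j < p.-1)%N -> pZloc j.+1 (elempoly harmseq)`_j.
Proof.
move=> jp; have /dvdzP[q qE] := dvdz_risepoly jp.
exists (q%:~R / ((p.-1)`!)%:R).
  by apply/Zloc_divn/coprime_factorial; rewrite prednK ?prime_gt0.
by rewrite coef_elempoly_harmseq qE intrM -pmulrn exprS; ring.
Qed.

End Padic.

(** * Lifting the generators of the ideal *)

Section Reduction.
Variables (R : comNzRingType) (n : nat).
Local Notation Lambda := (symfun R).
Local Notation hred := (@hred R n).

Lemma hred_zmod_morphism : zmod_morphism hred.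
Proof.
move=> f g; apply/eqP; rewrite eq_sym subr_eq; apply/eqP.
by rewrite -hredD subrK.
Qed.

Lemma hred_monoid_morphism : monoid_morphism hred.
Proof. by split=> [|f g]; last exact: esym (hredM n f g). Qed.

HB.instance Definition _ :=
  GRing.isZmodMorphism.Build Lambda (hquot R n) hred hred_zmod_morphism.
HB.instance Definition _ :=
  GRing.isMonoidMorphism.Build Lambda (hquot R n) hred hred_monoid_morphism.

(** The terms with $j\geq n$ are dropped because $e_j$ then vanishes in the quotient; those with
    $j<k$ may stay because their binomial coefficient is 0. *)
Definition beta_lift k : Lambda :=
  elemsym R k + \sum_(0 <= j < n) (-1) ^+ j.+1 * 'C(j, k)%:R * elemsym R j.

Lemma hred_beta_lift k : hred (beta_lift k) = beta R n k.
Proof.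
rewrite /beta_lift /beta rmorphD rmorph_sum /=; congr (_ + _).
pose F j := (-1) ^+ j.+1 * 'C(j, k)%:R * hred (elemsym R j).
transitivity (\sum_(0 <= j < n) F j).
  apply: eq_bigr => j _.
  by rewrite rmorphM /= rmorphM /= rmorph_sign rmorph_nat.
rewrite fsbig_seq ?iota_uniq // [LHS](fsbig_widen _ setT) => //; last first.
  move=> j [_ /= jn]; rewrite /F hred_elemsym ?mulr0 //.
  by rewrite leqNgt; apply/negP => nj; apply: jn; rewrite mem_index_iota.
symmetry; apply: fsbig_widen => // j [_ /= kj].
by rewrite bin_small ?mulr0 ?mul0r // ltnNge; apply/negP.
Qed.

End Reduction.

(** * Estimates for large primes and the conclusion *)

Definition for_large_primes (P : nat -> Prop) : Prop :=
  exists p0, forall p, prime p -> (p0 <= p)%N -> P p.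

Lemma for_large_primes_and (P Q : nat -> Prop) :
  for_large_primes P -> for_large_primes Q -> for_large_primes (fun p => P p /\ Q p).
Proof.
move=> [a aP] [b bQ]; exists (maxn a b) => p p_pr; rewrite geq_max => /andP[ap bp].
by split; [exact: aP | exact: bQ].
Qed.

Lemma for_large_primes_all (I : eqType) (r : seq I) (P : I -> nat -> Prop) :
  (forall i, i \in r -> for_large_primes (P i)) ->
  for_large_primes (fun p => forall i, i \in r -> P i p).
Proof.
elim: r => [|x r IHr] rP; first by exists 0%N.
have [|p0 h] := for_large_primes_and (rP x (mem_head x r)) (IHr _).
  by move=> i ir; apply: rP; rewrite inE ir orbT.
exists p0 => p p_pr /(h _ p_pr)[Px Pr] i; rewrite inE => /predU1P[->//|].
exact: Pr.
Qed.

Lemma evalat_emon_pZloc (l : {cmonom nat}) :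
  for_large_primes (fun p => pZloc p (hdeg l) (evalat (harmseq p) (emon rat l))).
Proof.
(* The sharper divisibility of $e_{i+1}$ needs $i+1<p-1$, that is $i+3\leq p$. *)
exists (\max_(i <- finsupp l) i.+3) => p p_pr lp.
rewrite /hdeg /emon rmorph_prod /= !big_seq.
apply: (big_ind2 (fun m x => pZloc p m x)) => [|m x m' x'|i il].
- exact: (pZloc_int _ 1).
- exact: pZlocM.
rewrite rmorphXn /= evalat_elemsym; apply/pZlocX/coef_harmseq_pZlocS => //.
have : (i.+3 <= p)%N by apply: leq_trans lp; exact: (@leq_bigmax_seq _ _ _ (fun i => i.+3)).
by lia.
Qed.

(** Applied at level [n] to the remainder, and at level 0 to obtain $p$-integrality of the value of
    an arbitrary symmetric function. *)
Lemma evalat_hideal n (g : symfun rat) : g \in hideal n ->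
  for_large_primes (fun p => pZloc p n (evalat (harmseq p) g)).
Proof.
move=> /hidealP gn; set L := msupp (ecoord g) in gn.
have [l lL|p0 h] := @for_large_primes_all _ L (fun l p =>
  pZloc p n (evalat (harmseq p) ((ecoord g)@_l *: emon rat l))).
  have [a h] := evalat_emon_pZloc l; set c := _@_l.
  (* A prime exceeding the denominator of [c] does not divide it, so [c] is $p$-integral. *)
  exists (maxn a `|denq c|.+1) => p p_pr; rewrite geq_max => /andP[ap cp].
  rewrite evalatZ; apply: (pZlocW (gn l lL)) => //.
  apply: (@pZlocM _ 0%N) => //; last exact: h.
  exists c; last by rewrite mul1r.
  rewrite unfold_in prime_coprime //; apply/negP => /dvdn_leq.
  by rewrite absz_gt0 denq_neq0 leqNgt cp => /(_ isT).
exists p0 => p p_pr pp; rewrite -[g]ecoordK epolyE rmorph_sum /=.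
by apply: pZloc_sum => // l lL _; exact: h.
Qed.

Lemma evalat_beta_lift n k :
  for_large_primes (fun p => pZloc p n (evalat (harmseq p) (beta_lift rat n k))).
Proof.
exists 3%N => p p_pr p3.
have p_odd : odd p by have [p2|//] := even_prime p_pr; rewrite p2 in p3.
set E := elempoly (harmseq p).
(* The bound [n + size E] is at least [size E], so the full relation holds, and at least [n], so it
   can be split there. *)
have tailE : evalat (harmseq p) (beta_lift rat n k) =
    (-1)%:~R * \sum_(n <= j < n + size E) (-1) ^+ j.+1 * 'C(j, k)%:R * E`_j.
  have := coef_elempoly_harmseq_sym p_pr k p_odd (leq_addl n (size E)).
  rewrite (big_cat_nat (leq0n _) (leq_addr _ n)) /= addrA => /eqP.
  rewrite addr_eq0 => /eqP headE; rewrite mulN1r -headE rmorphD rmorph_sum /=.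
  rewrite evalat_elemsym; congr (_ + _); apply: eq_bigr => j _.
  by rewrite rmorphM /= rmorphM /= rmorph_sign rmorph_nat evalat_elemsym.
rewrite tailE; apply: (@pZlocM _ 0%N) => //; first exact: pZloc_int.
rewrite big_nat_cond; apply: pZloc_sum => // j _ /andP[/andP[nj _] _].
apply: (@pZlocM _ 0%N) => //.
  have -> : (-1) ^+ j.+1 * 'C(j, k)%:R = ((-1) ^+ j.+1 * 'C(j, k)%:R : int)%:~R :> rat.
    by rewrite intrM rmorphXn /= natz -pmulrn.
  exact: pZloc_int.
by apply: (pZlocW nj) => //; exact: coef_harmseq_pZloc.
Qed.

Theorem theorem3p3 (n : nat) (f : symfun rat)
    (hf : ideal_generated (beta rat n) (hred n f)) :
  exists p0 : nat, forall p : nat, prime p -> (p0 <= p)%N ->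
    eqmod_Zloc p n
      (symeval f [seq p%:R / i%:R | i <- iota 1 p.-1]) 0.
Proof.
have [N [a fE]] := hf.
pose A k : symfun rat := repr (a k).
pose g := f - \sum_(k < N) A k * beta_lift rat n k.
have gn : g \in hideal n.
  apply/hredP; rewrite fE rmorph_sum /=; apply: eq_bigr => k _.
  by rewrite rmorphM /= hred_beta_lift /A hred_repr.
have [k _|p0 h] := @for_large_primes_all _ (enum 'I_N) (fun k p =>
  pZloc p n (evalat (harmseq p) (A k * beta_lift rat n k))).
  (* No bound on the H-degree of [A k] is available, but integrality of its value is enough:
     [beta_lift] supplies the whole factor $p^n$. *)
  have A0 : A k \in hideal 0 by apply/hidealP => l _; exact: leq0n.
  have [p0 h] := for_large_primes_and (evalat_hideal A0) (evalat_beta_lift n k).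
  exists p0 => p p_pr pp; rewrite rmorphM /=; have [hA hB] := h p p_pr pp.
  exact: (@pZlocM _ 0%N).
have [p1 h1] := evalat_hideal gn.
exists (maxn p0 p1) => p p_pr; rewrite geq_max => /andP[pp0 pp1].
suff [z zp fz] : pZloc p n (evalat (harmseq p) f) by exists z; rewrite ?subr0.
have -> : f = g + \sum_(k < N) A k * beta_lift rat n k by rewrite subrK.
rewrite rmorphD rmorph_sum /=; apply: pZlocD => //; first exact: h1.
by apply: pZloc_sum => // k _ _; apply: h => //; rewrite mem_enum.
Qed.
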